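(* Let $d, n, N$ be positive integers with $n \le N$, let $N_1,\ldots,N_{d+1}$ be nonnegative integers with $N_1+\dots+N_{d+1}=N$, put $\boldsymbol{N}=(N_1,\ldots,N_d)$ and $p_i = N_i/N$ for $i\in\{1,\ldots,d\}$, and let $\boldsymbol{X}=(X_1,\ldots,X_d)\sim \mathrm{Hypergeometric}_d(N,n,\boldsymbol{N})$. Then, for all $\boldsymbol{\alpha}=(\alpha_1,\ldots,\alpha_d)\in\mathbb{K}_d$, $$ \begin{aligned} &\mathsf{E}\left\{\prod_{i=1}^d (X_i-\mathsf{E}[X_i])^{\alpha_i}\right\} \\ &= \sum_{\ell_1=0}^{\alpha_1} \cdots \sum_{\ell_d=0}^{\alpha_d} \sum_{k_1=0}^{\ell_1} \cdots \sum_{k_d=0}^{\ell_d} \frac{n^{(\|\boldsymbol{k}\|_1)}}{N^{(\|\boldsymbol{k}\|_1)}} \left(\frac{-n}{N}\right)^{\sum_{i=1}^d(\alpha_i-\ell_i)} \prod_{i=1}^d \binom{\alpha_i}{\ell_i} \genfrac\{\}{0pt}{}{\ell_i}{k_i} N_i^{\alpha_i-\ell_i} N_i^{(k_i)} \\ &= \sum_{\ell_1=0}^{\alpha_1} \cdots \sum_{\ell_d=0}^{\alpha_d} \sum_{k_1=0}^{\ell_1} \cdots \sum_{k_d=0}^{\ell_d} \left\{\frac{\prod_{i=1}^d (N p_i)^{(k_i)}}{N^{(\|\boldsymbol{k}\|_1)} \prod_{i=1}^d p_i^{k_i}}\right\} n^{(\|\boldsymbol{k}\|_1)} (-n)^{\sum_{i=1}^d(\alpha_i-\ell_i)}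 \prod_{i=1}^d \binom{\alpha_i}{\ell_i} \genfrac\{\}{0pt}{}{\ell_i}{k_i} p_i^{\alpha_i-\ell_i+k_i}, \end{aligned} $$ where $\boldsymbol{k}=(k_1,\ldots,k_d)$, $\binom{\alpha}{\ell}=\frac{\alpha!}{\ell!(\alpha-\ell)!}$ is the binomial coefficient, and $\genfrac\{\}{0pt}{}{\ell}{k}$ denotes the Stirling number of the second kind.
   Context: Notation: $\mathbb{N}_0$ is the set of nonnegative integers; $\|\boldsymbol{x}\|_1=\sum_{i=1}^d |x_i|$ for $\boldsymbol{x}\in\mathbb{R}^d$; $\mathcal{S}_d=\{\boldsymbol{x}\in[0,1]^d:\|\boldsymbol{x}\|_1\le 1\}$. For $x\in\mathbb{R}$ and $m\in\mathbb{N}_0$, $x^{(m)}=x(x-1)\cdots(x-m+1)$ is the falling factorial, with $x^{(0)}=1$; ordinary powers are written $x^m$, with $0^0=1$. The Stirling number of the second kind $\genfrac\{\}{0pt}{}{\ell}{k}$ is the number of ways to partition a set of $\ell$ objects into $k$ non-empty subsets (so $\genfrac\{\}{0pt}{}{0}{0}=1$). Multivariate hypergeometric distribution: given positive integers $n\le N$ and nonnegative integers $N_1,\ldots,N_{d+1}$ with $N_1+\dots+N_{d+1}=N$, set $$\mathbb{K}_d=\{\boldsymbol{k}\in\mathbb{N}_0^d\cap n\mathcal{S}_d : k_i\in[0,N_i]\text{ for all } i\in\{1,\ldots,d\}\},$$ i.e. the vectors $\boldsymbol{k}\in\mathbb{N}_0^d$ with $k_i\le N_i$ for all $i\in\{1,\ldots,d\}$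 and $\|\boldsymbol{k}\|_1\le n$. A random vector $\boldsymbol{X}=(X_1,\ldots,X_d)$ has the $\mathrm{Hypergeometric}_d(N,n,\boldsymbol{N})$ distribution, with $\boldsymbol{N}=(N_1,\ldots,N_d)$ and $N_{d+1}=N-\|\boldsymbol{N}\|_1$, if its probability mass function is $$P_{N,n,\boldsymbol{N}}(\boldsymbol{k})=\binom{N}{n}^{-1}\prod_{i=1}^{d+1}\binom{N_i}{k_i},\quad \boldsymbol{k}\in\mathbb{K}_d,$$ where $k_{d+1}=n-\|\boldsymbol{k}\|_1$ (and $\binom{a}{b}=0$ when $b>a$ for nonnegative integers $a,b$). *)

(* Defs.v *)
From HB Require Import structures.
From mathcomp Require Import all_boot all_order all_algebra.
From mathcomp Require Import all_classical all_reals all_analysis.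

Set Implicit Arguments.
Unset Strict Implicit.
Unset Printing Implicit Defensive.

Import Order.TTheory GRing.Theory Num.Theory.
Import numFieldNormedType.Exports.

Local Open Scope classical_set_scope.
Local Open Scope ring_scope.

(* x^(m) = x (x - 1) ... (x - m + 1); MathComp's [n ^_ m] only covers x in nat. *)
Definition falling (R : realType) (x : R) (m : nat) : R :=
  \prod_(i < m) (x - i%:R).

Definition stirling2 (l k : nat) : nat :=
  #|[set Q : {set {set 'I_l}} |
      finset.partition Q [set: 'I_l] & #|Q| == k]%SET|.

Definition norm1 (d : nat) (k : 'I_d -> nat) : nat := (\sum_(i < d) k i)%N.

Definition hgeom_supp (d n : nat) (Nv : 'I_d -> nat) : set ('I_d -> nat) :=
  [set k | (forall i, (k i <= Nv i)%N) /\ (norm1 k <= n)%N].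

(* The last factor is the one of index d + 1, with N_(d+1) = N - ||Nv||_1 and
   k_(d+1) = n - ||k||_1.  Neither subtraction truncates when ||Nv||_1 <= N
   and k is in [hgeom_supp n Nv]. *)
Definition hgeom_pmf (R : realType) (d N n : nat) (Nv k : 'I_d -> nat) : R :=
  ('C(N, n)%:R)^-1 *
  ((\prod_(i < d) 'C(Nv i, k i)%:R) * 'C(N - norm1 Nv, n - norm1 k)%:R).

(* X = (X_1, ..., X_d) ~ Hypergeometric_d(N, n, Nv).  By Vandermonde's identity
   the masses below add up to 1, so X lies in [hgeom_supp n Nv] almost surely. *)
Definition hypergeometric (disp : measure_display) (T : measurableType disp)
    (R : realType) (P : probability T R) (d : nat) (X : 'I_d -> {RV P >-> R})
    (N n : nat) (Nv : 'I_d -> nat) : Prop :=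
  forall k : 'I_d -> nat, hgeom_supp n Nv k ->
    P [set t | forall i, X i t = (k i)%:R] = (hgeom_pmf R N n Nv k)%:E.

(* Main.v *)
(** Let x^(k) denote the falling factorial.  Expanding (X_i - mu_i)^(alpha_i) by
the binomial theorem and then x^l = sum_k S(l, k) x^(k) reduces the statement to
the mixed factorial moments E[prod_i X_i^(k_i)].

The Stirling expansion counts the x^l maps from an l-set to an x-set according
to their kernel: the maps with a given kernel of k blocks are the x^(k)
injections of the blocks.

Since j^(k) C(M, j) is the coefficient of Y^j in Y^k times the k-th derivative
of (1 + Y)^M, a mixed factorial moment is, up to 1 / C(N, n), the coefficient of
Y^n in prod_i (N_i^(k_i) Y^(k_i) (1 + Y)^(N_i - k_i)) * (1 + Y)^(N_(d+1)),
that is, prod_i N_i^(k_i) C(N - |k|, n - |k|).  The case k = 0 is Vandermonde's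
identity: it says that X almost surely lies in the support, so that expectations
are finite sums. *)

Require Import Defs.
From HB Require Import structures.
From mathcomp Require Import all_boot all_order all_algebra.
From mathcomp Require Import all_classical all_reals all_analysis.
From mathcomp Require Import measurable_realfun.
From mathcomp Require Import ring.

Set Implicit Arguments.
Unset Strict Implicit.
Unset Printing Implicit Defensive.

Import Order.TTheory GRing.Theory Num.Theory.
Import numFieldNormedType.Exports.

Local Open Scope classical_set_scope.
Local Open Scope ring_scope.

(** The upper summation limits vary with the coordinate, so products of sums are distributed over
    dependent functions. [bigA_distr_big_dep] yields functions into a tagged union; those whose
    value at [i] has tag [i] are the elements of [fprod J]. *)
Lemma bigA_distr_dffun (R : comNzRingType) (I : finType) (J : I -> finType)
    (F : forall i, J i -> R) :
  \prod_(i : I) \sum_(j : J i) F i j =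
  \sum_(f : {dffun forall i : I, J i}) \prod_(i : I) F i (f i).
Proof.
pose P_ i := [ffun j => F i j].
rewrite (reindex (@dffun_of_fprod _ J)); last exact/onW_bij/dffun_of_fprod_bij.
transitivity (\sum_(t : fprod J) \prod_(i : I) P_ i (t i)); last first.
  by apply: eq_bigr => t _; apply: eq_bigr => i _; rewrite !ffunE.
rewrite (big_fprod (R := R)).
transitivity (\prod_i \sum_(j | tagged_with J i j) untag 0 (P_ i) j); last first.
  exact: bigA_distr_big_dep.
apply: eq_bigr => i _; rewrite (eq_bigr (P_ i)) => [|j _]; last by rewrite ffunE.
exact: (big_tag P_).
Qed.

(** * Stirling numbers and powers *)

Section Stirling.
(* [classical_sets] shadows [partition], [pblock] and their lemmas. *)
Import mathcomp.boot.finset.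

(** A map with kernel [Q] factors uniquely through the projection [block], and the factor is
    injective because distinct blocks carry distinct values. So [phi] sends the injections of the
    blocks bijectively onto these maps. *)
Lemma card_ffun_kernel (l x : nat) (Q : {set {set 'I_l}}) :
  partition Q [set: 'I_l]%SET ->
  #|[set f : {ffun 'I_l -> 'I_x} |
      preim_partition f [set: 'I_l]%SET == Q]%SET| = (x ^_ #|Q|)%N.
Proof.
move=> partQ; have [/eqP covQ tiQ Q0] := and3P partQ.
have blockQ i : pblock Q i \in Q by rewrite pblock_mem // covQ inE.
pose D := {B : {set 'I_l} | B \in Q}.
pose block i : D := exist _ (pblock Q i) (blockQ i).
(* Blocks are non-empty, so [block] is onto: this makes [phi] injective and lets [xchoose] pick a
   representative of each block. *)
have blockP (B : D) : exists i, block i == B.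
  have /set0Pn[i iB] : val B != set0 by exact: (memPn Q0) (valP B).
  by exists i; apply/eqP/val_inj => /=; apply: def_pblock => //; exact: (valP B).
pose phi (g : {ffun D -> 'I_x}) : {ffun 'I_l -> 'I_x} :=
  [ffun i => g (block i)].
have phi_inj : injective phi.
  move=> g h /ffunP gh; apply/ffunP => B; have [i /eqP <-] := blockP B.
  by have := gh i; rewrite !ffunE.
have cardD : #|{: D}| = #|Q| by rewrite card_sig; apply: eq_card => B; rewrite !inE.
rewrite -cardD -[in RHS](card_ord x) -card_inj_ffuns -(card_imset _ phi_inj).
apply: eq_card => f; rewrite !inE; apply/eqP/imsetP.
  move=> kerf.
  have fE i j : block i = block j -> f i = f j.
    move=> [] /eqP; rewrite eq_pblock ?covQ ?inE // -kerf.
    rewrite pblock_equivalence_partition ?inE //.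
      by move/eqP.
    by move=> ? ? ? _ _ _; split=> // /eqP ->.
  have fE' i j : f i = f j -> block i = block j.
    move=> fij; apply: val_inj => /=; apply/eqP.
    rewrite eq_pblock ?covQ ?inE // -kerf.
    rewrite pblock_equivalence_partition ?inE ?fij //.
    by move=> ? ? ? _ _ _; split=> // /eqP ->.
  exists [ffun B => f (xchoose (blockP B))]; last first.
    apply/ffunP => i; rewrite !ffunE; apply: fE.
    by rewrite (eqP (xchooseP (blockP _))).
  rewrite inE; apply/injectiveP => B C; rewrite !ffunE => /fE'.
  by rewrite (eqP (xchooseP (blockP B))) (eqP (xchooseP (blockP C))).
move=> [g]; rewrite inE => /injectiveP injg ->.
(* [Q] is the kernel of [pblock Q], and composing with the injective [g] does not change the
   kernel. *)
rewrite -[RHS](preim_partition_pblock partQ).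
rewrite /preim_partition /equivalence_partition.
apply: eq_imset => i; apply/setP => j; rewrite !inE /=.
by rewrite !ffunE (inj_eq injg) -val_eqE.
Qed.

Lemma expn_stirling2 (x l : nat) :
  (x ^ l = \sum_(k < l.+1) stirling2 l k * x ^_ k)%N.
Proof.
(* The blocks are non-empty, so there are at most [l] of them and [inord] below returns their true
   number. *)
have cardQ (Q : {set {set 'I_l}}) :
    partition Q [set: 'I_l]%SET -> (#|Q| < l.+1)%N.
  move=> partQ; rewrite ltnS -[leqRHS](card_ord l) -cardsT.
  rewrite (card_partition partQ) -sum1_card.
  apply: leq_sum => B BQ; rewrite card_gt0.
  by have /and3P[_ _ Q0] := partQ; exact: (memPn Q0).
rewrite -[in LHS](card_ord x) -[in LHS](card_ord l) -card_ffun -sum1_card.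
rewrite (partition_big (fun f : {ffun 'I_l -> 'I_x} => preim_partition f [set: 'I_l]%SET)
  (fun Q => partition Q [set: 'I_l]%SET)) /=; last first.
  by move=> f _; exact: preim_partitionP.
transitivity (\sum_(Q : {set {set 'I_l}} | partition Q [set: 'I_l]%SET)
   (x ^_ #|Q|))%N.
  by apply: eq_bigr => Q partQ; rewrite -card_ffun_kernel // -sum1dep_card.
rewrite (partition_big (fun Q : {set {set 'I_l}} => inord #|Q| : 'I_l.+1) predT) //=.
apply: eq_bigr => k _; rewrite /stirling2 -sum1_card big_distrl /=.
apply: eq_big => [Q|Q /andP[partQ /eqP <-]].
  rewrite inE; case partQ: partition => //=.
  by rewrite -val_eqE /= inordK // cardQ.
by rewrite mul1n inordK // cardQ.
Qed.

End Stirling.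

(** * Falling factorials and polynomial coefficients *)

Lemma falling_nat (R : realType) (x m : nat) :
  falling (x%:R : R) m = (x ^_ m)%:R.
Proof.
rewrite /falling ffact_prod natr_prod; have [mx|xm] := leqP m x.
  by apply: eq_bigr => i _; rewrite natrB // (leq_trans _ mx) // ltnW.
(* Here [x < m], and the factor of index [x] vanishes in both products. *)
by rewrite (bigD1 (Ordinal xm)) //= [RHS](bigD1 (Ordinal xm)) //= subrr subnn !mul0r.
Qed.

Lemma ffactnD (n j k : nat) : (n ^_ (j + k) = n ^_ j * (n - j) ^_ k)%N.
Proof.
elim: k => [|k IHk]; first by rewrite addn0 ffactn0 muln1.
by rewrite addnS !ffactnSr IHk -mulnA subnDA.
Qed.

(** After multiplication by $(j-k)!$ both sides equal $N^{(j)}$. *)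
Lemma ffact_mul_bin (N j k : nat) : (k <= j)%N ->
  (N ^_ k * 'C(N - k, j - k) = j ^_ k * 'C(N, j))%N.
Proof.
move=> kj; apply/eqP; rewrite -(eqn_pmul2r (fact_gt0 (j - k))).
rewrite -mulnA bin_ffact mulnAC ffact_fact // [eqbRHS]mulnC bin_ffact.
by rewrite -ffactnD subnKC.
Qed.

Lemma coef_1DX_pow (R : comNzRingType) (m j : nat) :
  (('X + 1) ^+ m : {poly R})`_j = 'C(m, j)%:R.
Proof.
rewrite addrC exprDn coef_sum.
under eq_bigr do rewrite expr1n mul1r coefMn coefXn.
have [jm|mj] := leqP j m.
  rewrite (bigD1 (Ordinal (jm : (j < m.+1)%N))) //= eqxx big1 ?addr0 // => i.
  by rewrite -val_eqE /= eq_sym => /negPf ->; rewrite mul0rn.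
rewrite bin_small // big1 // => i _.
by rewrite gtn_eqF ?mul0rn // (leq_ltn_trans _ mj) // -ltnS.
Qed.

(* [X^k] times the [k]-th derivative of [(1 + X)^N]. *)
Definition ffact_binpoly (R : comNzRingType) (N k : nat) : {poly R} :=
  (N ^_ k)%:R *: ('X^k * ('X + 1) ^+ (N - k)).

Lemma coef_ffact_binpoly (R : comNzRingType) (N k j : nat) :
  (ffact_binpoly R N k)`_j = (j ^_ k * 'C(N, j))%:R.
Proof.
rewrite coefZ coefXnM; case: ltnP => jk.
  by rewrite mulr0 ffact_small.
by rewrite coef_1DX_pow -natrM ffact_mul_bin.
Qed.

(** The size bound lets all exponents range over one finite type. Tuples of sum above [n] have to be
    left out: they contribute nothing, whereas the truncated subtraction would pick the constant
    coefficient of [q]. *)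
Lemma coef_prod_mul (R : comNzRingType) (d M n : nat)
    (p : 'I_d -> {poly R}) (q : {poly R}) :
  (forall i, (size (p i) <= M.+1)%N) ->
  ((\prod_(i < d) p i) * q)`_n =
  \sum_(x : {ffun 'I_d -> 'I_M.+1} | (norm1 (fun i => x i) <= n)%N)
    (\prod_(i < d) (p i)`_(x i)) * q`_(n - norm1 (fun i => x i)).
Proof.
move=> sp; have -> : \prod_(i < d) p i =
    \prod_(i < d) \sum_(j < M.+1) (p i)`_j *: 'X^j.
  apply: eq_bigr => i _; rewrite -poly_def; apply/polyP => j.
  rewrite coef_poly; case: ltnP => // Mj.
  by rewrite nth_default // (leq_trans (sp i)).
rewrite bigA_distr_bigA /= mulr_suml coef_sum [RHS]big_mkcond /=.
apply: eq_bigr => x _; rewrite scaler_prod prodrXr.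
by rewrite -scalerAl coefZ coefXnM ltnNge; case: leqP; rewrite ?mulr0.
Qed.

(** Every $N_i$ is at most $N$, so the tuples over ['I_N.+1] cover the support; where some $x_i$
    exceeds $N_i$, a binomial coefficient makes the mass zero. *)
Lemma hgeom_pmf_factorial_moment (R : realType) (d n N : nat)
    (Nv k : 'I_d -> nat) (Nlast : nat) :
  (n <= N)%N -> (\sum_(i < d) Nv i + Nlast)%N = N -> (norm1 k <= n)%N ->
  \sum_(x : {ffun 'I_d -> 'I_N.+1} | (norm1 (fun i => x i) <= n)%N)
     (\prod_(i < d) falling (x i)%:R (k i)) * hgeom_pmf R N n Nv (fun i => x i)
  = falling n%:R (norm1 k) / falling N%:R (norm1 k)
    * \prod_(i < d) falling (Nv i)%:R (k i).
Proof.
move=> nN hN kn; have kN := leq_trans kn nN.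
have NvN i : (Nv i <= N)%N by rewrite -hN (bigD1 i) //= -addnA leq_addr.
have NlastE : (N - norm1 Nv)%N = Nlast by rewrite -hN addKn.
have sizeNv i : (size (ffact_binpoly R (Nv i) (k i)) <= N.+1)%N.
  apply/leq_sizeP => j Nj; rewrite coef_ffact_binpoly bin_small ?muln0 //.
  exact: leq_ltn_trans (NvN i) Nj.
have := coef_prod_mul n (('X + 1) ^+ Nlast) sizeNv.
have -> : \prod_(i < d) ffact_binpoly R (Nv i) (k i) * ('X + 1) ^+ Nlast =
    (\prod_(i < d) (Nv i ^_ k i)%:R) *: ('X^(norm1 k) * ('X + 1) ^+ (N - norm1 k)).
  rewrite scaler_prod -scalerAl.
  (* The exponents add up to $N-\|k\|_1$ when no $N_i-k_i$ truncates. If some $k_i>N_i$, both sides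
     vanish because $N_i^{(k_i)}=0$. *)
  have [/forallP kNv|] := boolP [forall i, (k i <= Nv i)%N].
    congr (_ *: _); rewrite big_split /= prodrXr -mulrA; congr (_ * _).
    rewrite prodrXr -exprD; congr (_ ^+ _).
    by rewrite -hN sumnB // addnBAC // leq_sum.
  rewrite negb_forall => /existsP[i]; rewrite -ltnNge => kNv.
  by rewrite (bigD1 i) //= ffact_small // mul0r !scale0r.
rewrite coefZ coefXnM ltnNge kn /= coef_1DX_pow => sumE.
have CNn : 'C(N, n)%:R != 0 :> R by rewrite pnatr_eq0 -lt0n bin_gt0.
have fNk : (N ^_ norm1 k)%:R != 0 :> R by rewrite pnatr_eq0 -lt0n ffact_gt0.
transitivity ('C(N, n)%:R^-1 *
    ((\prod_(i < d) (Nv i ^_ k i)%:R) * 'C(N - norm1 k, n - norm1 k)%:R) : R).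
  rewrite sumE mulr_sumr; apply: eq_bigr => x _.
  rewrite /hgeom_pmf NlastE mulrCA; congr (_ * _).
  rewrite mulrA -big_split coef_1DX_pow /=; congr (_ * _).
  by apply: eq_bigr => i _; rewrite falling_nat coef_ffact_binpoly natrM.
(* What remains is $\binom{N-\|k\|_1}{n-\|k\|_1}/\binom{N}{n}=n^{(\|k\|_1)}/N^{(\|k\|_1)}$, an
   instance of [ffact_mul_bin]. *)
under [in RHS]eq_bigr do rewrite falling_nat.
rewrite !falling_nat mulrCA mulrC; congr (_ * _).
rewrite mulrC; apply/eqP; rewrite eqr_div // -!natrM; apply/eqP; congr (_%:R).
by rewrite [RHS]mulnC [in RHS]mulnC -ffact_mul_bin // mulnC.
Qed.

(** * Expectations as finite sums *)

(** The disjoint events [A k] have total mass one, so [h] agrees almost everywhere with the simple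
    function [g]; the two can differ only outside the union [U], on a null set. *)
Lemma expectation_finite_partition (disp : measure_display)
    (T : measurableType disp) (R : realType) (P : probability T R)
    (K : finType) (S : pred K) (A : K -> set T) (h : T -> R) (c : K -> R) :
  measurable_fun setT h -> (forall k, measurable (A k)) ->
  trivIset [set k | S k] A -> (\sum_(k | S k) P (A k) = 1)%E ->
  (forall k t, S k -> A k t -> h t = c k) ->
  'E_P[h]%E = (\sum_(k | S k) c k * fine (P (A k)))%:E.
Proof.
move=> mh mA tA PA hc.
pose g t := (\sum_(k | S k) c k * \1_(A k) t).
pose U := \bigcup_(k in [set k | S k]) A k.
have mU : measurable U by apply: fin_bigcup_measurable.
have PU : P U = 1%E.
  have SE : [set k | S k] = [set` enum S].
    by apply/seteqP; split=> k /=; rewrite mem_enum.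
  rewrite measure_fin_bigcup //; last exact: finite_finset.
  by rewrite SE -fsbig_seq ?enum_uniq // big_enum.
have mg : measurable_fun setT g.
  rewrite /g; under eq_fun do rewrite big_mkcond /=.
  apply: measurable_sum => k; case: (S k) => //.
  by apply: measurable_funM => //; exact: measurable_indic.
have iA k : P.-integrable setT (fun t => (\1_(A k) t)%:E) by exact: integrable_indic.
rewrite unlock (@ae_eq_integral _ _ _ P setT (EFin \o g)) //=; last 3 first.
- exact/measurable_EFinP.
- exact/measurable_EFinP.
- exists (~` U); split.
  + exact: measurableC.
  + by have := probability_setC P mU; rewrite PU subee.
  + move=> t /= + Ut; apply => _; case: Ut => k Sk Akt.
    rewrite (hc k) // /g (bigD1 k) //= indicE mem_set // mulr1 big1 ?addr0 //.
    move=> j /andP[Sj jk]; rewrite indicE memNset ?mulr0 // => Ajt.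
    by move/eqP: jk; apply; apply: tA => //; exists t.
under eq_integral do rewrite /g -sumEFin big_mkcond /=.
rewrite integral_sum //; last first.
  move=> k; case: (S k); last exact: integrable0.
  under eq_fun do rewrite EFinM.
  exact: (integrableZl _ (c k) (iA k)).
rewrite -sumEFin [RHS]big_mkcond /=; apply: eq_bigr => k _.
case: (S k); last by rewrite integral0.
under eq_integral do rewrite EFinM.
rewrite (integralZl _ (iA k)) // integral_indic // setIT EFinM fineK //.
exact: fin_num_measure.
Qed.

Lemma hgeom_pmf_sum (R : realType) (d n N : nat) (Nv : 'I_d -> nat)
    (Nlast : nat) :
  (n <= N)%N -> (\sum_(i < d) Nv i + Nlast)%N = N ->
  \sum_(x : {ffun 'I_d -> 'I_N.+1} | (norm1 (fun i => x i) <= n)%N)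
     hgeom_pmf R N n Nv (fun i => x i) = 1.
Proof.
move=> nN hN; have falling0 (x : R) : falling x 0 = 1 by exact: big_ord0.
have prod0 (u : 'I_d -> R) : \prod_(i < d) falling (u i) 0 = 1 by exact: big1.
have norm0 : norm1 (fun _ : 'I_d => 0%N) = 0%N by exact: big1.
have := @hgeom_pmf_factorial_moment R d n N Nv (fun=> 0%N) Nlast nN hN.
rewrite norm0 => /(_ isT); rewrite !falling0 divr1 mul1r prod0 => <-.
by apply: eq_bigr => x _; rewrite prod0 mul1r.
Qed.

Lemma expectation_hypergeometric (R : realType) (disp : measure_display)
    (T : measurableType disp) (P : probability T R) (d n N : nat)
    (Nv : 'I_d -> nat) (Nlast : nat) (X : 'I_d -> {RV P >-> R})
    (h : T -> R) (c : ('I_d -> nat) -> R) :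
  (n <= N)%N -> (\sum_(i < d) Nv i + Nlast)%N = N ->
  hypergeometric X N n Nv -> measurable_fun setT h ->
  (forall x t, (forall i, X i t = (x i)%:R) -> h t = c x) ->
  'E_P[h]%E = (\sum_(x : {ffun 'I_d -> 'I_N.+1} | (norm1 (fun i => x i) <= n)%N)
     c (fun i => x i) * hgeom_pmf R N n Nv (fun i => x i))%:E.
Proof.
move=> nN hN hX mh hc.
pose K := {ffun 'I_d -> 'I_N.+1}.
(* [hypergeometric] prescribes masses only on the support, hence the bounds $x_i\le N_i$. [sumS]
   removes them again, since the mass function vanishes where they fail. *)
pose S (x : K) := (norm1 (fun i => x i) <= n)%N && [forall i, (x i <= Nv i)%N].
pose A (x : K) := [set t | forall i, X i t = (x i : nat)%:R].
have PA x : S x -> P (A x) = (hgeom_pmf R N n Nv (fun i => x i))%:E.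
  by move=> /andP[xn /forallP xN]; apply: (hX (fun i => x i)).
have sumS (u : K -> R) :
    \sum_(x | S x) u x * hgeom_pmf R N n Nv (fun i => x i) =
    \sum_(x : K | (norm1 (fun i => x i) <= n)%N)
      u x * hgeom_pmf R N n Nv (fun i => x i).
  rewrite big_mkcondr /=; apply: eq_bigr => x _.
  case: ifP => // /negbT; rewrite negb_forall => /existsP[i]; rewrite -ltnNge => xN.
  by rewrite /hgeom_pmf (bigD1 i) //= (bin_small xN) !(mulr0n, mul0r, mulr0).
rewrite (@expectation_finite_partition _ _ _ P K S A h (fun x => c (fun i => x i))) //.
- congr EFin; rewrite -sumS; apply: eq_bigr => x Sx; congr (_ * _).
  by rewrite PA.
- move=> x; have -> : A x = \bigcap_(i in [set: 'I_d]) (X i @^-1` [set (x i : nat)%:R]).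
    by apply/seteqP; split=> t /= xt i; [move=> _|]; apply: xt.
  by apply: fin_bigcap_measurable => // i _; exact: measurable_funPTI.
- move=> x y /= _ _ [t [xt yt]]; apply/ffunP => i; apply/val_inj.
  by apply/eqP; rewrite -(eqr_nat R) -xt -yt.
- rewrite (eq_bigr _ PA) sumEFin; congr EFin.
  rewrite -(hgeom_pmf_sum R nN hN).
  under eq_bigr do rewrite -[hgeom_pmf _ _ _ _ _]mul1r.
  under [RHS]eq_bigr do rewrite -[hgeom_pmf _ _ _ _ _]mul1r.
  exact: (sumS (fun=> 1)).
- by move=> x t _ Axt; apply: hc.
Qed.

(** * Central moments *)

Lemma exprB_falling (R : realType) (x a : nat) (m : R) :
  (x%:R - m) ^+ a =
  \sum_(l < a.+1) \sum_(k < l.+1)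
    'C(a, l)%:R * (stirling2 l k)%:R * (- m) ^+ (a - l) * falling x%:R k.
Proof.
rewrite addrC exprDn; apply: eq_bigr => l _.
rewrite -natrX expn_stirling2 natr_sum -mulr_natl mulrA mulr_sumr.
by apply: eq_bigr => k _; rewrite natrM falling_nat; ring.
Qed.

(** The mean is the mixed factorial moment for the unit vector at [i], whose norm 1 is at most
    [n]. *)
Lemma expectation_hypergeometric_coord (R : realType) (disp : measure_display)
    (T : measurableType disp) (P : probability T R) (d n N : nat)
    (Nv : 'I_d -> nat) (Nlast : nat) (X : 'I_d -> {RV P >-> R}) (i : 'I_d) :
  (0 < n)%N -> (n <= N)%N -> (\sum_(i < d) Nv i + Nlast)%N = N ->
  hypergeometric X N n Nv ->
  'E_P[X i]%E = (n%:R / N%:R * (Nv i)%:R)%:E.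
Proof.
move=> n0 nN hN hX.
rewrite (expectation_hypergeometric (c := fun x => (x i)%:R) nN hN hX) //.
congr EFin; pose k (j : 'I_d) := nat_of_bool (j == i).
have k1 : norm1 k = 1%N by rewrite /norm1 (bigD1 i) //= /k eqxx big1 // => j /negPf ->.
have prodk (x : 'I_d -> nat) :
    \prod_(j < d) falling ((x j)%:R : R) (k j) = (x i)%:R.
  rewrite (bigD1 i) //= /k eqxx falling_nat ffactn1 big1 ?mulr1 // => j /negPf ->.
  by rewrite falling_nat.
have := @hgeom_pmf_factorial_moment R d n N Nv k Nlast nN hN.
rewrite k1 => /(_ n0); rewrite prodk !falling_nat !ffactn1 => <-.
by apply: eq_bigr => x _; rewrite (prodk (fun j => x j)).
Qed.

(** Once the sum over [x] is moved inside, each pair [l], [k] leaves one mixed factorial moment.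
    This works for any centre [m]; the means are inserted in the theorem. *)
Lemma expectation_hypergeometric_expansion (R : realType)
    (disp : measure_display) (T : measurableType disp) (P : probability T R)
    (d n N : nat) (Nv : 'I_d -> nat) (Nlast : nat) (X : 'I_d -> {RV P >-> R})
    (alpha : 'I_d -> nat) (m : 'I_d -> R) :
  (n <= N)%N -> (\sum_(i < d) Nv i + Nlast)%N = N ->
  hypergeometric X N n Nv -> (norm1 alpha <= n)%N ->
  'E_P[fun t => (\prod_(i < d) (X i t - m i) ^+ alpha i)%R]%E =
    (\sum_(l : {dffun forall i : 'I_d, 'I_(alpha i).+1})
     \sum_(k : {dffun forall i : 'I_d, 'I_(l i).+1})
       (\prod_(i < d) ('C(alpha i, l i)%:R * (stirling2 (l i) (k i))%:R
                       * (- m i) ^+ (alpha i - l i)))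
       * (falling n%:R (norm1 (fun i => k i)) / falling N%:R (norm1 (fun i => k i))
          * \prod_(i < d) falling (Nv i)%:R (k i)))%:E.
Proof.
move=> nN hN hX alphan.
rewrite (expectation_hypergeometric
  (c := fun x => \prod_(i < d) ((x i)%:R - m i) ^+ alpha i) nN hN hX); first last.
- by move=> x t Xx; apply: eq_bigr => i _; rewrite Xx.
- by apply: measurable_prod => i _; apply: measurable_funX; exact: measurable_funB.
congr EFin.
transitivity (\sum_(x : {ffun 'I_d -> 'I_N.+1} | (norm1 (fun i => x i) <= n)%N)
  \sum_(l : {dffun forall i : 'I_d, 'I_(alpha i).+1})
  \sum_(k : {dffun forall i : 'I_d, 'I_(l i).+1})
    (\prod_(i < d) ('C(alpha i, l i)%:R * (stirling2 (l i) (k i))%:R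
                    * (- m i) ^+ (alpha i - l i)))
    * ((\prod_(i < d) falling (x i)%:R (k i))
       * hgeom_pmf R N n Nv (fun i => x i))).
  apply: eq_bigr => x _.
  under eq_bigr do rewrite exprB_falling.
  rewrite bigA_distr_dffun mulr_suml; apply: eq_bigr => l _.
  rewrite bigA_distr_dffun mulr_suml; apply: eq_bigr => k _.
  by rewrite big_split /= -mulrA.
rewrite exchange_big; apply: eq_bigr => l _.
rewrite exchange_big; apply: eq_bigr => k _.
rewrite -mulr_sumr (hgeom_pmf_factorial_moment R nN hN) //.
(* From $k_i\le\ell_i\le\alpha_i$ follows $\|k\|_1\le n$, as the factorial moment formula
   requires. *)
apply: leq_trans alphan; apply: leq_sum => i _.
by rewrite (leq_trans (_ : k i <= l i)%N) // -ltnS.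
Qed.

Theorem theorem2 (R : realType) (disp : measure_display)
    (T : measurableType disp) (P : probability T R)
    (d n N : nat) (hd : (0 < d)%N) (hn : (0 < n)%N) (hnN : (n <= N)%N)
    (Nv : 'I_d -> nat) (Nlast : nat) (hN : (\sum_(i < d) Nv i + Nlast)%N = N)
    (p : 'I_d -> R) (hp : forall i, p i = (Nv i)%:R / N%:R)
    (X : 'I_d -> {RV P >-> R}) (hX : hypergeometric X N n Nv)
    (alpha : 'I_d -> nat) (halpha : hgeom_supp n Nv alpha) :
  let mu := ('E_P[fun t =>
      (\prod_(i < d) (X i t - fine 'E_P[X i]%E) ^+ alpha i)%R])%E in
  mu =
    (\sum_(l : {dffun forall i : 'I_d, 'I_(alpha i).+1})
     \sum_(k : {dffun forall i : 'I_d, 'I_(l i).+1})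
       falling n%:R (norm1 (fun i => k i)) / falling N%:R (norm1 (fun i => k i))
       * (- n%:R / N%:R) ^+ (\sum_(i < d) (alpha i - l i))%N
       * \prod_(i < d) ('C(alpha i, l i)%:R * (stirling2 (l i) (k i))%:R
                        * (Nv i)%:R ^+ (alpha i - l i)
                        * falling (Nv i)%:R (k i)))%:E
  /\
  mu =
    (\sum_(l : {dffun forall i : 'I_d, 'I_(alpha i).+1})
     \sum_(k : {dffun forall i : 'I_d, 'I_(l i).+1})
       (\prod_(i < d) falling (N%:R * p i) (k i))
         / (falling N%:R (norm1 (fun i => k i)) * \prod_(i < d) p i ^+ k i)
       * falling n%:R (norm1 (fun i => k i))
       * (- n%:R) ^+ (\sum_(i < d) (alpha i - l i))%N
       * \prod_(i < d) ('C(alpha i, l i)%:R * (stirling2 (l i) (k i))%:R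
                        * p i ^+ (alpha i - l i + k i)))%:E.
Proof.
move=> mu; have [alphaN alphan] := halpha.
have N0 : N%:R != 0 :> R by rewrite pnatr_eq0 -lt0n (leq_trans hn).
have muE : mu = 'E_P[fun t =>
    (\prod_(i < d) (X i t - n%:R / N%:R * (Nv i)%:R) ^+ alpha i)%R]%E.
  rewrite /mu; congr expectation; apply/funext => t; apply: eq_bigr => i _.
  by rewrite (expectation_hypergeometric_coord i hn hnN hN hX).
rewrite muE (expectation_hypergeometric_expansion _ hnN hN hX alphan).
split; congr EFin; apply: eq_bigr => l _; apply: eq_bigr => k _.
  (* The power of $-n/N$ is distributed over the coordinates, which leaves an identity for each
     [i]. *)
  rewrite mulrCA -!mulrA; congr (_ * _); congr (_ * _).
  rewrite -prodrXr -!big_split /=; apply: eq_bigr => i _.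
  by rewrite -!mulNr exprMn; move: (_ ^+ _) => u; ring.
(* If p_i = 0, then k_i <= alpha_i <= N_i = 0, so that p_i ^ k_i = 1. *)
have p0 i : p i ^+ k i != 0.
  have [Nv0|Nv0] := posnP (Nv i); last first.
    by rewrite expf_neq0 // hp mulf_neq0 ?invr_eq0 // pnatr_eq0 -lt0n.
  suff -> : (k i : nat) = 0%N by rewrite expr0 oner_neq0.
  apply/eqP; rewrite -leqn0 -Nv0 (leq_trans _ (alphaN i)) //.
  by rewrite (leq_trans (_ : k i <= l i)%N) // -ltnS.
have Np i : N%:R * p i = (Nv i)%:R by rewrite hp mulrC divfK.
have mp i : - (n%:R / N%:R * (Nv i)%:R) = - n%:R * p i by rewrite hp; ring.
under [in RHS]eq_bigr do rewrite Np.
rewrite invfM -[(\prod_(i < d) p i ^+ k i)^-1]prodfV.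
(* Both sides are brought to the form [F * G] times products over [i]. It then suffices to compare
   factors, where $p_i^{k_i}$ cancels by [p0]. *)
set F := falling n%:R _; set G := (falling N%:R _)^-1.
rewrite [LHS](_ : _ = F * G * \prod_(i < d)
  ('C(alpha i, l i)%:R * (stirling2 (l i) (k i))%:R * (- n%:R * p i) ^+ (alpha i - l i)
    * falling (Nv i)%:R (k i))); last first.
  rewrite mulrCA -big_split; congr (_ * _); apply: eq_bigr => i _.
  by rewrite mp.
rewrite [RHS](_ : _ = F * G * ((\prod_(i < d) falling (Nv i)%:R (k i)) *
  (\prod_(i < d) (p i ^+ k i)^-1) * (- n%:R) ^+ (\sum_(i < d) (alpha i - l i)) *
  \prod_(i < d) ('C(alpha i, l i)%:R * (stirling2 (l i) (k i))%:R
     * p i ^+ (alpha i - l i + k i)))); last by ring.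
congr (_ * _); rewrite -prodrXr -!big_split /=; apply: eq_bigr => i _.
by rewrite exprMn exprD; field; apply: p0.
Qed.
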